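(* Let $m<N$ and let $A\in\mathbb{R}^{m\times N}$ have full row rank and rows $a_1,\dots,a_m$ of unit Euclidean norm. Let $X$ be an $\mathbb{R}^N$-valued random vector with $\mathbb{E}\|X\|^2<\infty$, let $W$ be an $\mathbb{R}^m$-valued random vector with $\mathbb{E}W=0$ and $\mathbb{E}\|W\|^2<\infty$, and let $Z$ be a random variable with values in $[m]=\{1,\dots,m\}$ with $\Pr\{Z=i\}=\lambda_i>0$ for all $i\in[m]$. Let $\{X_k\}_{k\ge1},\{W_k\}_{k\ge1},\{Z_k\}_{k\ge1}$ be IID copies of $X,W,Z$ respectively, with the three sequences jointly independent, and set $Y_k:=AX_k+W_k$, $\mathcal{Y}_k:=Y_k(Z_k)$ (the $Z_k$-th component of $Y_k$), and $Y:=AX+W$. Let $\{\eta_k\}_{k\ge0}$ be positive step sizes with $\sum_k\eta_k=\infty$ and $\sum_k\eta_k^2<\infty$. Fix $x_0\in\mathbb{R}^N$ and define $\alpha_0=0\in\mathbb{R}^m$ and $$\alpha_{k+1}=\alpha_k+\eta_k\big[\tilde Y_{k+1}-e_{Z_{k+1}}A(x_0+A'\alpha_k)\big],\quad k\ge0,$$ where $e_{j}$ denotes the $m\times m$ matrix with $1$ in its $(j,j)$ entry and zeros elsewhere, and $\tilde Y_{k+1}\in\mathbb{R}^m$ is the vector whose $Z_{k+1}$-th entry is $\mathcal{Y}_{k+1}$ and whose other entries are $0$. Then, almost surely, $$\alpha_k\to\alpha^*:=(AA')^{-1}(\mathbb{E}Y-Ax_0)\quad\text{as }k\to\infty.$$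
   Context: $A'$ denotes the transpose of $A$; $\|\cdot\|$ is the Euclidean norm. Equivalently, the iterates $x_k:=x_0+A'\alpha_k$ satisfy the stochastic Kaczmarz recursion $x_{k+1}=x_k+\eta_k[\mathcal{Y}_{k+1}-\langle a_{Z_{k+1}},x_k\rangle]a_{Z_{k+1}}$. *)

(* Defs.v *)
From HB Require Import structures.
From mathcomp Require Import all_boot all_order all_algebra.
From mathcomp Require Import all_classical all_reals all_analysis.
Set Implicit Arguments. Unset Strict Implicit. Unset Printing Implicit Defensive.
Import Order.TTheory GRing.Theory Num.Theory.
Import numFieldNormedType.Exports.
Local Open Scope classical_set_scope.
Local Open Scope ring_scope.

Section defs.
Variable R : realType.

Definition eucl_norm n (v : 'rV[R]_n) : R := Num.sqrt (\sum_j v 0 j ^+ 2).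

(** The Borel sigma-algebra on R^n (column vectors 'cV_n): the product
    sigma-algebra, generated by the coordinate cylinders {v | v_i in B}. *)
Definition vec_measurable n : set (set 'cV[R]_n) :=
  smallest (sigma_algebra setT)
    [set C | exists (i : 'I_n) (B : set R), measurable B /\
                                             C = [set v : 'cV[R]_n | B (v i 0)]].

Context d (T : measurableType d).

Definition random_vector n (f : T -> 'cV[R]_n) :=
  forall S, vec_measurable S -> measurable (f @^-1` S).

Definition random_index m (f : T -> 'I_m) :=
  forall S : set 'I_m, measurable (f @^-1` S).

Definition sigma_vec n (f : T -> 'cV[R]_n) : set (set T) :=
  [set E | exists S, vec_measurable S /\ E = f @^-1` S].
Definition sigma_index m (f : T -> 'I_m) : set (set T) :=
  [set E | exists S : set 'I_m, E = f @^-1` S].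

Variable P : probability T R.

Definition mutually_independent (I : eqType) (F : I -> set (set T)) :=
  forall (J : seq I) (E : I -> set T), uniq J ->
    (forall j, j \in J -> F j (E j)) ->
    P (\big[setI/setT]_(j <- J) E j) = (\prod_(j <- J) P (E j))%E.

Definition same_law_vec n (f g : T -> 'cV[R]_n) :=
  forall S, vec_measurable S -> P (f @^-1` S) = P (g @^-1` S).
Definition same_law_index m (f g : T -> 'I_m) :=
  forall S : set 'I_m, P (f @^-1` S) = P (g @^-1` S).

End defs.

(** The iteration alpha_{k+1} = alpha_k + eta_k [Ytilde_{k+1} - e_{Z_{k+1}} A (x0 + A' alpha_k)],
    alpha_0 = 0.  The sequences are 0-indexed: Ys k = Y_{k+1}, z k = Z_{k+1}. *)
Fixpoint kaczmarz_alpha (R : realType) m N (A : 'M[R]_(m, N)) (x0 : 'cV[R]_N)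
    (eta : nat -> R) (Ys : nat -> 'cV[R]_m) (z : nat -> 'I_m) (k : nat)
    : 'cV[R]_m :=
  match k with
  | 0 => 0
  | k'.+1 =>
    let a := kaczmarz_alpha A x0 eta Ys z k' in
    let Ytil := \col_i (if i == z k' then Ys k' (z k') 0 else 0) in
    a + eta k' *: (Ytil - delta_mx (z k') (z k') *m (A *m (x0 + A^T *m a)))
  end.

(* Main.v *)
(** Let G = A A', beta_k = alpha_k - alpha* and V_k = sum_i beta_k(i)^2 / lam_i.
    Weighting by 1 / lam_i compensates the probability of updating coordinate i:
    conditionally on the past,
      E V_{k+1} = V_k - 2 eta_k <beta_k, G beta_k>
                  + eta_k^2 (E|xi|^2 + |G beta_k|^2),
    where xi = Y - E Y.  As G is positive definite, this is at most
    (1 + C eta_k^2 - c eta_k) V_k + C eta_k^2 with c > 0.  With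
    s_k = sum_(i < k) eta_i^2 and S its limit,
      U_k = exp(- C s_k) V_k + C (S - s_k)
    is a nonnegative supermartingale whose expectation decreases by at least a
    multiple of eta_k E V_k; since sum eta_k diverges, E U_k tends to 0.  The
    maximal inequality P(sup_(j >= n) U_j >= e) <= E U_n / e then gives U_k -> 0,
    hence V_k -> 0, almost surely.

    Conditional expectations are avoided: the (super)martingale inequalities are
    integrated over arbitrary events of the sigma-algebra of the past. *)
Require Import Defs.
From HB Require Import structures.
From mathcomp Require Import all_boot all_order all_algebra.
From mathcomp Require Import all_classical all_reals all_analysis.
From mathcomp Require Import measurable_realfun ring lra.
Import Order.TTheory GRing.Theory Num.Theory.
Import numFieldNormedType.Exports.
Local Open Scope classical_set_scope.
Local Open Scope ring_scope.

Set Implicit Arguments.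
Unset Strict Implicit.
Unset Printing Implicit Defensive.

(** * Independence *)

Definition independent_systems {d} {T : measurableType d} {R : realType}
    (P : probability T R) (G H : set_system T) :=
  forall A B, G A -> H B -> P (A `&` B) = (P A * P B)%E.

Lemma independent_systemsC {d} {T : measurableType d} {R : realType}
    (P : probability T R) (G H : set_system T) :
  independent_systems P G H -> independent_systems P H G.
Proof. by move=> GH A B HA GB; rewrite setIC muleC; exact: GH. Qed.

(** Dynkin's pi-lambda argument: for a fixed [B] in [H], the measurable events independent of [B]
    form a lambda-system, here [D], and it contains the pi-system [G]. *)
Lemma independent_systems_generatedl {d} {T : measurableType d} {R : realType}
    (P : probability T R) (G H : set_system T) :
  setI_closed G -> G `<=` measurable -> H `<=` measurable ->
  independent_systems P G H -> independent_systems P <<s G >> H.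
Proof.
move=> GI Gm Hm GH A B sGA HB; have mB := Hm _ HB.
pose D := [set E : set T | measurable E /\ P (E `&` B) = (P E * P B)%E].
suff : <<s G >> `<=` D by move=> /(_ _ sGA)[].
apply: lambda_system_subset => //; last by move=> E GE; split; [exact: Gm|exact: GH].
apply/dynkin_lambda_system; split.
- by split => //; rewrite setTI probability_setT mul1e.
- move=> E [mE EB]; split; first exact: measurableC.
  rewrite setIC -setDE measureD// ?(le_lt_trans (probability_le1 _ _)) ?ltry//.
  rewrite [X in (_ - P X)%E]setIC EB probability_setC//.
  by rewrite muleBl ?mul1e// ?fin_num_adde_defr// ?fin_num_measure.
- move=> F tF DF; have mF n : measurable (F n) by have [] := DF n.
  split; first exact: bigcup_measurable.
  rewrite setI_bigcupl measure_bigcup//; last 2 first.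
    by move=> n _; exact: measurableI.
    by under eq_fun do rewrite setIC; exact: trivIset_setIl.
  rewrite measure_bigcup// muleC -[P B]fineK ?fin_num_measure// -nneseriesZl//.
  apply: eq_eseriesr => n _; apply: etrans (proj2 (DF n)) _.
  by rewrite fineK ?fin_num_measure// muleC.
Qed.

Lemma independent_systems_generated {d} {T : measurableType d} {R : realType}
    (P : probability T R) (G H : set_system T) :
  setI_closed G -> G `<=` measurable -> setI_closed H -> H `<=` measurable ->
  independent_systems P G H -> independent_systems P <<s G >> <<s H >>.
Proof.
move=> GI Gm HI Hm GH; apply: independent_systems_generatedl => //.
  exact: smallest_sub (sigma_algebra_measurable _) Hm.
apply: independent_systemsC; apply: independent_systems_generatedl => //.
exact: independent_systemsC.
Qed.

(** Finite intersections of events taken from the [F i] with [i] in [S] form a pi-system, and the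
    sigma-algebra it generates contains that of the block [S]. For disjoint blocks, the product
    formula over a concatenated index list factors into the two parts. *)
Lemma mutually_independent_generated {d} {T : measurableType d} {R : realType}
    (P : probability T R) (I : choiceType) (F : I -> set_system T) (S1 S2 : set I) :
  (forall i, F i `<=` measurable) -> (forall i, F i setT) ->
  (forall i, setI_closed (F i)) -> [disjoint S1 & S2] ->
  mutually_independent P F ->
  independent_systems P <<s \bigcup_(i in S1) F i >> <<s \bigcup_(i in S2) F i >>.
Proof.
move=> Fm FT FI S12 indF.
pose pi (S : set I) := [set E | exists J : seq I, exists e : I -> set T,
  [/\ uniq J, [set` J] `<=` S, forall j, j \in J -> F j (e j) &
      E = \big[setI/setT]_(j <- J) e j]].
have pim S : pi S `<=` measurable.
  move=> _ [J [e [_ _ Je ->]]]; rewrite -bigcap_seq.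
  apply: fin_bigcap_measurable => // j /= jJ; exact/(Fm j)/Je.
have piI S : setI_closed (pi S).
  move=> _ _ [J1 [e1 [_ S1J eJ1 ->]]] [J2 [e2 [_ S2J eJ2 ->]]].
  (* Both intersections are put over the merged index list, padded with [setT] where an index is
     missing. *)
  exists (undup (J1 ++ J2)), (fun j => (if j \in J1 then e1 j else setT) `&`
                                       (if j \in J2 then e2 j else setT)).
  split; first exact: undup_uniq.
  - by move=> j /=; rewrite mem_undup mem_cat => /orP[/S1J|/S2J].
  - move=> j _; apply: FI; case: ifPn => // jJ; [exact: eJ1|exact: eJ2].
  - rewrite -!bigcap_seq; apply/seteqP; split => t /=.
      by move=> [t1 t2] j _; split; case: ifPn => // jJ; [exact: t1|exact: t2].
    move=> tJ; split => j /= jJ.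
      by have := tJ j; rewrite /= mem_undup mem_cat jJ => /(_ isT)[].
    by have := tJ j; rewrite /= mem_undup mem_cat jJ orbT => /(_ isT)[].
have Fpi S : <<s \bigcup_(i in S) F i >> `<=` <<s pi S >>.
  apply: sub_sigma_algebra2 => E [i Si FiE]; exists [:: i], (fun=> E).
  split => //; last by rewrite big_seq1.
    by move=> j /=; rewrite inE => /eqP ->.
  by move=> j; rewrite inE => /eqP ->.
move=> A B /Fpi sA /Fpi sB.
apply: independent_systems_generated sA sB => //.
move=> _ _ [J1 [e1 [u1 S1J eJ1 ->]]] [J2 [e2 [u2 S2J eJ2 ->]]].
have J12 j : j \in J1 -> j \in J2 -> False.
  move=> /S1J s1 /S2J s2.
  by move: S12 => /disj_setPS/(_ j) ; apply.
(* [J1] and [J2] are disjoint, so one family of events serves both lists and mutual independence can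
   be applied to [J1 ++ J2]. *)
pose e j := if j \in J1 then e1 j else e2 j.
have E1 : \big[setI/setT]_(j <- J1) e1 j = \big[setI/setT]_(j <- J1) e j.
  by apply: eq_big_seq => j jJ; rewrite /e jJ.
have E2 : \big[setI/setT]_(j <- J2) e2 j = \big[setI/setT]_(j <- J2) e j.
  by apply: eq_big_seq => j jJ; rewrite /e; case: ifPn => // /J12; move=> /(_ jJ).
have eF1 j : j \in J1 -> F j (e j) by move=> jJ; rewrite /e jJ; exact: eJ1.
have eF2 j : j \in J2 -> F j (e j).
  by move=> jJ; rewrite /e; case: ifPn => [/J12/(_ jJ)//|_]; exact: eJ2.
rewrite E1 E2 -big_cat indF; first last.
- by move=> j; rewrite mem_cat => /orP[/eF1|/eF2].
- rewrite cat_uniq u1 u2 andbT /=; apply/hasPn => j jJ2; apply/negP => jJ1.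
  exact: J12 jJ1 jJ2.
by rewrite big_cat/= (indF J1)// (indF J2).
Qed.

(** The law of the pair [(f, g)] agrees with the product of the two laws on rectangles, hence
    everywhere. Tonelli then gives integrability of the product and Fubini its value. *)
Lemma independent_integrableM {d} {T : measurableType d} {R : realType}
    (P : probability T R) (f g : T -> R) :
  (forall A B, measurable A -> measurable B ->
    P (f @^-1` A `&` g @^-1` B) = (P (f @^-1` A) * P (g @^-1` B))%E) ->
  P.-integrable setT (EFin \o f) -> P.-integrable setT (EFin \o g) ->
  P.-integrable setT (EFin \o (f \* g)) /\
  \int[P]_t (f t * g t) = \int[P]_t f t * \int[P]_t g t.
Proof.
move=> fg intf intg.
have mf : measurable_fun setT f by apply/measurable_EFinP; exact: measurable_int intf.
have mg : measurable_fun setT g by apply/measurable_EFinP; exact: measurable_int intg.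
pose f' : {mfun T >-> R} := HB.pack f (isMeasurableFun.Build _ _ _ _ _ mf).
pose g' : {mfun T >-> R} := HB.pack g (isMeasurableFun.Build _ _ _ _ _ mg).
pose h t := (f t, g t).
have mh : measurable_fun setT h by exact: measurable_fun_pair.
pose h' : {mfun T >-> (R * R)%type} := HB.pack h (isMeasurableFun.Build _ _ _ _ _ mh).
pose m1 := distribution P f'; pose m2 := distribution P g'.
have m12 : forall X : set (R * R)%type, measurable X ->
    (m1 \x m2)%E X = distribution P h' X.
  by apply: product_measure_unique => A B mA mB; exact: fg.
have int12 q : (\int[m1 \x m2]_z q z = \int[distribution P h']_z q z)%E.
  by apply: eq_measure_integral => A mA _; exact: m12.
pose p (xy : (R * R)%type) := (xy.1 * xy.2)%:E.
have mp : measurable_fun setT p.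
  by apply/measurable_EFinP; apply: measurable_funM.
have mabsp : measurable_fun setT (abse \o p) by exact: measurableT_comp.
have mabs : measurable_fun [set: R] (fun y : R => `|y|%:E).
  by apply/measurable_EFinP; exact: normr_measurable.
have mpx x : measurable_fun [set: R] (fun y => p (x, y)).
  by apply/measurable_EFinP; exact: mulrl_measurable.
have mZr c : measurable_fun [set: R] (fun x : R => x%:E * c%:E)%E.
  by apply/measurable_EFinP; exact: mulrr_measurable.
have absp0 y : (0 <= (abse \o p) y)%E by exact: abse_ge0.
(* By Tonelli, the expectation of |f g| is the product of those of |f| and |g|, which are finite. *)
have int_abs : (\int[P]_t `|p (h t)| < +oo)%E.
  have -> : (\int[P]_t `|p (h t)| = \int[m1]_x \int[m2]_y `|p (x, y)|)%E.
    rewrite -(ge0_integral_distribution h' mabsp absp0).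
    by rewrite -int12 fubini_tonelli1.
  have E x : (\int[m2]_y `|p (x, y)| = `|x|%:E * \int[P]_t `|(g t)%:E|)%E.
    under eq_integral do rewrite /p/= normrM EFinM.
    rewrite ge0_integralZl//.
    congr (_ * _)%E.
    rewrite (@ge0_integral_distribution _ _ _ _ _ P g' (fun y => `|y|%:E))//.
  under eq_integral do rewrite E.
  rewrite ge0_integralZr//; last exact: integral_ge0.
  rewrite (@ge0_integral_distribution _ _ _ _ _ P f' (fun y => `|y|%:E))//.
  move: intf intg => /integrableP[_ +] /integrableP[_ +] /=.
  move=> ilty jlty; rewrite lte_mul_pinfty ?integral_ge0//.
  by rewrite ge0_fin_numE ?integral_ge0.
have intp : P.-integrable setT (EFin \o (f \* g)).
  apply/integrableP; split => //.
  by apply/measurable_EFinP; exact: measurable_funM.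
split=> //.
have intp' : (m1 \x m2)%E.-integrable setT p.
  apply/integrableP; split => //.
  rewrite int12.
  by rewrite (ge0_integral_distribution h' mabsp absp0).
rewrite /Rintegral.
have -> : (\int[P]_t (f t * g t)%:E = \int[m1 \x m2]_z p z)%E.
  rewrite int12.
  by rewrite integral_distribution.
rewrite -integral12_prod_meas1// /fubini_F.
have E x : (\int[m2]_y p (x, y) = x%:E * \int[P]_t (g t)%:E)%E.
  rewrite (@integral_distribution _ _ _ _ _ P g' (fun y => p (x, y)))//.
  + by rewrite /p/=; under eq_integral do rewrite EFinM; rewrite integralZl.
  + rewrite /p/= /comp/=.
    by under eq_fun do rewrite EFinM; exact: integrableZl.
have -> : (\int[m1]_x \int[m2]_y p (x, y) =
    \int[m1]_x (x%:E * \int[P]_t (g t)%:E))%E.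
  by apply: eq_integral => x _; exact: E.
have fing := integrable_fin_num measurableT intg.
have finf := integrable_fin_num measurableT intf.
rewrite -fineM// -(fineK fing) -integralZr//.
by rewrite (@integral_distribution _ _ _ _ _ P f' (fun x => x%:E * _)%E)//; exact: integrableZr.
Qed.

(** * Almost sure convergence of nonnegative almost supermartingales *)

(** If [u] stayed above [e], then [v] would be at least [e / 2] once [tau] is below [e / 2]. From
    then on [u] would lose at least [b * (e / 2) * eta k] at step [k], and divergence of the steps
    would make it negative. *)
Lemma recursion_gets_small {R : realType} (u v eta tau : R^nat) (b : R) :
  0 < b -> (forall k, 0 < eta k) -> series eta @ \oo --> +oo ->
  (forall k, 0 <= u k) -> (forall k, u k <= v k + tau k) ->
  tau @ \oo --> 0 -> (forall k, u k.+1 <= u k - b * eta k * v k) ->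
  forall e, 0 < e -> exists n, u n < e.
Proof.
move=> b0 eta0 eta_oo u0 uv tau0 ustep e e0; apply: contrapT => /forallNP ue.
have {}ue n : e <= u n by rewrite leNgt; apply/negP; exact: ue.
have e20 : 0 < e / 2 by rewrite divr_gt0.
have [n0 _ tau_e] := cvgr_lt _ tau0 _ e20.
have ve k : (n0 <= k)%N -> e / 2 <= v k.
  by move=> /tau_e /= tk; have := uv k; have := ue k; lra.
have bound j : b * (e / 2) * (series eta (n0 + j)%N - series eta n0) <= u n0 - u (n0 + j)%N.
  elim: j => [|j ih]; first by rewrite addn0 !subrr mulr0.
  have := ustep (n0 + j)%N; have := ve (n0 + j)%N (leq_addr _ _).
  rewrite -addnS in ih *; rewrite addnS seriesSr in ih *.
  have bh : 0 < b * eta (n0 + j)%N by rewrite mulr_gt0.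
  move=> /(ler_wpM2l (ltW bh)); lra.
(* The threshold makes the accumulated loss after [n0] at least [u n0 + 1]. *)
have [n1 _ n1P] := (cvgryPge _).1 eta_oo (series eta n0 + (u n0 + 1) / (b * (e / 2))).
have be : 0 < b * (e / 2) by rewrite mulr_gt0.
have := n1P (n0 + n1)%N (leq_addl _ _).
rewrite /= -lerBrDl ler_pdivrMr// mulrC => h.
by have := bound n1; have := u0 (n0 + n1)%N; lra.
Qed.

(** A Markov inequality that keeps the integral over the part where [f] is below [e], so that it can
    be iterated in time. *)
Lemma Rintegral_split_lt {d} {T : measurableType d} {R : realType}
    (P : probability T R) (D : set T) (f : T -> R) (e : R) :
  measurable D -> P.-integrable setT (EFin \o f) ->
  \int[P]_(t in D `&` [set t | f t < e]) f t +
    e * fine (P (D `\` [set t | f t < e])) <= \int[P]_(t in D) f t.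
Proof.
move=> mD intf.
have mf : measurable_fun setT f by apply/measurable_EFinP; exact: measurable_int intf.
have mE : measurable [set t | f t < e].
  rewrite -[X in measurable X]setTI; exact: measurable_fun_ltr.
have DE : D = (D `&` [set t | f t < e]) `|` (D `\` [set t | f t < e]).
  by rewrite setDE -setIUr setUv setIT.
have mDE : measurable (D `&` [set t | f t < e]) by exact: measurableI.
have mDD : measurable (D `\` [set t | f t < e]) by exact: measurableD.
rewrite [in leRHS]DE Rintegral_setU//; last 2 first.
- by rewrite -DE; exact: integrableS intf.
- apply/disj_setPS => t [[_ /= ?] [_ ?]] //.
rewrite lerD2l -Rintegral_cst//; apply: le_Rintegral => //.
- exact: finite_measure_integrable_cst.
- exact: integrableS intf.
- by move=> t [_ /= /negP]; rewrite -leNgt.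
Qed.

Lemma fine_measure_setC_setI {d} {T : measurableType d} {R : realType}
    (P : probability T R) (A B : set T) : measurable A -> measurable B ->
  fine (P (~` (A `&` B))) = fine (P (~` A)) + fine (P (A `\` B)).
Proof.
move=> mA mB; rewrite -fineD ?fin_num_measure//; last 2 first.
- exact: measurableC.
- exact: measurableD.
rewrite -measureU//; last 3 first.
- exact: measurableC.
- exact: measurableD.
- by apply/seteqP; split => // t [nA [tA _]].
congr (fine (P _)); apply/seteqP; split => t /=.
  by move=> nAB; have [tA|?] := pselect (A t); [right; split => // tB; exact: nAB|left].
by move=> [nA [/nA]|[tA nB] [_ /nB]].
Qed.

(** * Maximal inequality for nonnegative supermartingales *)

Section maximal_inequality.
Context {d} {T : measurableType d} {R : realType} (P : probability T R).
Context (F : nat -> set_system T) (U : nat -> T -> R).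
(** [Flt] is adaptedness of [U] in the form in which it is used: cutting a past event by a sublevel
    set of [U k] gives again a past event. [Ustep] is the supermartingale property. *)
Hypotheses (Fm : forall k, F k `<=` measurable) (FT : forall k, F k setT)
  (Fmono : forall k, F k `<=` F k.+1)
  (Flt : forall k A r, F k A -> F k (A `&` [set t | U k t < r]))
  (U0 : forall k t, 0 <= U k t)
  (Uint : forall k, P.-integrable setT (EFin \o U k))
  (Ustep : forall k A, F k A ->
    \int[P]_(t in A) U k.+1 t <= \int[P]_(t in A) U k t).

(** Built one time at a time, so that [Flt] and [Fmono] place it in [F (n + j)] by induction. *)
Fixpoint stays_below (e : R) n j := if j is i.+1
  then stays_below e n i `&` [set t | U (n + i.+1)%N t < e]
  else [set t | U n t < e].

Lemma stays_below_adapted e n j : F (n + j) (stays_below e n j).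
Proof.
elim: j => [|j ih] /=; first by rewrite addn0 -[X in F _ X]setTI; exact: Flt.
by apply: Flt; rewrite addnS; exact: Fmono.
Qed.

Lemma stays_belowP e n j t : stays_below e n j t <->
  forall i, (i <= j)%N -> U (n + i)%N t < e.
Proof.
elim: j => [|j ih] /=; first by split => [h [|i]//|/(_ 0%N)]; rewrite addn0 // => /(_ isT).
split=> [[/ih h hj] i|h]; first by rewrite leq_eqVlt => /predU1P[->//|]; exact: h.
by split; [apply/ih => i ij; apply: h; exact: leqW|exact: h].
Qed.

(** The left side does not increase with [j]. On the paths still below [e], [Ustep] replaces
    [U (n + j)] by its successor; those that then reach [e] contribute at least [e] times their
    probability, which moves to the first term. This replaces a stopping time. *)
Lemma maximal_inequality_finite e n j :
  e * fine (P (~` stays_below e n j)) + \int[P]_(t in stays_below e n j) U (n + j) t <=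
  \int[P]_t U n t.
Proof.
elim: j => [|j ih].
  rewrite addn0 addrC; have := Rintegral_split_lt e (@measurableT _ T) (Uint n).
  by rewrite setTI setTD.
apply: le_trans ih.
have mG i : measurable (stays_below e n i) by exact/Fm/stays_below_adapted.
have mE : measurable [set t | U (n + j.+1)%N t < e].
  rewrite -[X in measurable X]setTI; apply: measurable_fun_ltr => //.
  by apply/measurable_EFinP; exact: measurable_int (Uint _).
have := Ustep (stays_below_adapted e n j).
have := Rintegral_split_lt e (mG j) (Uint (n + j.+1)).
by rewrite /= fine_measure_setC_setI// -addnS mulrDr; lra.
Qed.

(** The events increase with [j], so the finite bound passes to the union by continuity from
    below. *)
Lemma maximal_inequality e n : 0 < e ->
  (P (\bigcup_j ~` stays_below e n j) <= ((\int[P]_t U n t) / e)%:E)%E.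
Proof.
move=> e0.
have mG i : measurable (~` stays_below e n i).
  by apply: measurableC; exact/Fm/stays_below_adapted.
have nd : nondecreasing_seq (fun j => ~` stays_below e n j).
  apply/nondecreasing_seqP => j; apply/subsetPset; apply: subsetC => t /=; by case.
have := @nondecreasing_cvg_mu _ _ _ P _ mG (bigcup_measurable (fun i _ => mG i)) nd.
move=> /cvg_lim <-//; apply: lime_le.
  by apply: ereal_nondecreasing_is_cvgn => i j ij; apply: le_measure;
    rewrite ?inE//; exact/subsetPset/nd.
apply: nearW => j /=.
rewrite -[leLHS]fineK ?fin_num_measure// lee_fin ler_pdivlMr// mulrC.
apply: le_trans (maximal_inequality_finite e n j).
by rewrite lerDl; apply: Rintegral_ge0.
Qed.

Lemma supermartingale_cvg0 :
  (forall e, 0 < e -> exists n, \int[P]_t U n t < e) ->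
  {ae P, forall t, U ^~ t @ \oo --> 0}.
Proof.
move=> Usmall.
(* The paths that reach level [e] at arbitrarily late times; a path outside [bad e] for all
   [e = 1 / (i + 1)] tends to 0. *)
pose bad e := \bigcap_n \bigcup_j ~` stays_below e n j.
have mB e n : measurable (\bigcup_j ~` stays_below e n j).
  apply: bigcup_measurable => j _; apply: measurableC.
  exact/Fm/stays_below_adapted.
have bad0 e : 0 < e -> P.-negligible (bad e).
  move=> e0; have mbad : measurable (bad e) by exact: bigcap_measurableType.
  apply/negligibleP => //; apply/eqP; rewrite eq_le measure_ge0 andbT.
  apply/lee_addgt0Pr => x x0; rewrite add0e.
  (* With this [n] the maximal inequality bounds the probability of [bad e] by [x], which is
     arbitrary. *)
  have [n un] := Usmall (x * e) (mulr_gt0 x0 e0).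
  apply: (@le_trans _ _ (P (\bigcup_j ~` stays_below e n j))).
    by apply: le_measure; rewrite ?inE//; exact: bigcap_inf.
  apply: le_trans (maximal_inequality _ e0) _.
  by rewrite lee_fin ler_pdivrMr// ltW.
have nbad_all : P.-negligible (\bigcup_i bad i.+1%:R^-1).
  by apply: negligible_bigcup => i; apply: bad0; rewrite invr_gt0.
change (P.-negligible (~` [set t | U ^~ t @ \oo --> 0])).
apply: negligibleS nbad_all => t /= ncvg; apply: contrapT => nbad; apply: ncvg.
apply/cvgr0Pnorm_lt => e e0.
have [i ie] : exists i : nat, i.+1%:R^-1 < e.
  have [i ie] := @ltr_add_invr R 0 e e0; exists i; by rewrite add0r in ie.
have [n nP] : exists n, forall j, stays_below i.+1%:R^-1 n j t.
  apply: contrapT => /forallNP h; apply: nbad; exists i => // n _.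
  by have /existsNP[j hj] := h n; exists j.
exists n => // k /= nk; rewrite ger0_norm//; apply: le_lt_trans ie.
have /stays_belowP/(_ (k - n)%N (leqnn _)) := nP (k - n)%N.
by rewrite subnKC// => /ltW.
Qed.

End maximal_inequality.

Lemma almost_supermartingale_cvg0 {d} {T : measurableType d} {R : realType}
    (P : probability T R) (F : nat -> set_system T) (V : nat -> T -> R)
    (eta : R^nat) (c C : R) :
  (forall k, F k `<=` measurable) -> (forall k, F k setT) ->
  (forall k, F k `<=` F k.+1) ->
  (forall k A r, F k A -> F k (A `&` [set t | V k t < r])) ->
  (forall k t, 0 <= V k t) -> (forall k, P.-integrable setT (EFin \o V k)) ->
  0 < c -> 0 <= C -> (forall k, 0 < eta k) -> series eta @ \oo --> +oo ->
  cvgn (series (fun k => eta k ^+ 2)) ->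
  (forall k A, F k A -> \int[P]_(t in A) V k.+1 t <=
    (1 + C * eta k ^+ 2 - c * eta k) * \int[P]_(t in A) V k t +
    C * eta k ^+ 2 * fine (P A)) ->
  {ae P, forall t, V ^~ t @ \oo --> 0}.
Proof.
move=> Fm FT Fmono Flt V0 Vint c0 C0 eta0 eta_oo eta_sq Vstep.
pose s := series (fun k => eta k ^+ 2); pose S := limn s.
have s_ndecr : nondecreasing_seq s.
  by apply: nondecreasing_series => k _ _; exact: sqr_ge0.
have sS k : s k <= S by exact: nondecreasing_cvgn_le.
pose w k := expR (- C * s k).
have w_gt0 k : 0 < w k by exact: expR_gt0.
have s_ge0 k : 0 <= s k by apply: sumr_ge0 => i _; exact: sqr_ge0.
have w_le1 k : w k <= 1.
  by rewrite -expR0 ler_expR mulNr oppr_le0 mulr_ge0.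
have wS k : expR (- C * S) <= w k.
  by rewrite ler_expR !mulNr lerN2 ler_wpM2l.
(* By 1 + y <= exp y with y = [C * eta k ^+ 2], the drop of the weight absorbs the growth factor of
   [V]. *)
have wSr k : w k.+1 * (1 + C * eta k ^+ 2) <= w k.
  have -> : w k.+1 = w k * expR (- C * eta k ^+ 2) by rewrite /w /s seriesSr mulrDr expRD.
  rewrite -mulrA ger_pMr ?expR_gt0//.
  rewrite mulNr expRN mulrC ler_pdivrMr ?expR_gt0// mul1r.
  exact: expR_ge1Dx.
pose U k t := w k * V k t + C * (S - s k).
have Uint k : P.-integrable setT (EFin \o U k).
  apply: (@integrableD _ _ _ P setT measurableT (fun t => (w k * V k t)%:E)
    (fun=> (C * (S - s k))%:E)) => //.
    exact: (integrableZl measurableT (w k) (Vint k)).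
  exact: finite_measure_integrable_cst.
have IU k A : measurable A -> \int[P]_(t in A) U k t =
    w k * \int[P]_(t in A) V k t + C * (S - s k) * fine (P A).
  move=> mA; have VA := integrableS measurableT mA (@subsetT _ A) (Vint k).
  rewrite RintegralD//; last 2 first.
  - exact: (integrableZl mA (w k) VA).
  - exact: finite_measure_integrable_cst.
  by rewrite RintegralZl// Rintegral_cst.
have VA0 k A : 0 <= \int[P]_(t in A) V k t by apply: Rintegral_ge0.
have PA0 A : 0 <= fine (P A) by exact: fine_ge0.
have b0 : 0 < c * expR (- C * S) by rewrite mulr_gt0// expR_gt0.
have Ustep k A : F k A -> \int[P]_(t in A) U k.+1 t <=
    \int[P]_(t in A) U k t - c * expR (- C * S) * eta k * \int[P]_(t in A) V k t.
  move=> FA; have mA := Fm _ _ FA; rewrite !IU//.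
  have := Vstep _ _ FA; move: (VA0 k A) (PA0 A).
  have -> : s k.+1 = s k + eta k ^+ 2 by rewrite /s seriesSr.
  set v := \int[P]_(t in A) V k t; set v' := \int[P]_(t in A) V k.+1 t.
  set p := fine (P A) => v_ge0 p0 vstep.
  (* [h1] weights the recursion, [h2] absorbs the growth factor, [h3] keeps a drift with a rate free
     of [k], and [h4] charges the additive noise to the decrease of [C * (S - s k)]. *)
  have h1 := ler_wpM2l (ltW (w_gt0 k.+1)) vstep.
  have h2 := ler_wpM2r v_ge0 (wSr k).
  have h3 : expR (- C * S) * (c * eta k * v) <= w k.+1 * (c * eta k * v).
    by apply: ler_wpM2r (wS _); rewrite !mulr_ge0// ltW.
  have h4 : w k.+1 * (C * eta k ^+ 2 * p) <= 1 * (C * eta k ^+ 2 * p).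
    by apply: ler_wpM2r (w_le1 _); rewrite !mulr_ge0// ?sqr_ge0// ltW.
  lra.
have U0 k t : 0 <= U k t.
  by rewrite addr_ge0// mulr_ge0// ?subr_ge0// ltW.
have : {ae P, forall t, U ^~ t @ \oo --> 0}.
  apply: (@supermartingale_cvg0 _ _ _ _ F) => //.
  - move=> k A r FA.
    (* [U k] is an increasing affine function of [V k] with deterministic coefficients, so both have
       the same sublevel sets up to a change of level. *)
    rewrite (_ : [set t | U k t < r] = [set t | V k t < (r - C * (S - s k)) / w k]).
      exact: Flt.
    apply/seteqP; split => t /=; by rewrite ltr_pdivlMr// ltrBrDr mulrC.
  - move=> k A FA; apply: le_trans (Ustep _ _ FA) _.
    by rewrite gerBl !mulr_ge0// ltW// ?expR_gt0.
  - apply: (@recursion_gets_small _ _ (fun k => \int[P]_t V k t) eta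
      (fun k => C * (S - s k)) (c * expR (- C * S))) => //.
    + by move=> k; exact: Rintegral_ge0.
    + move=> k; rewrite IU// probability_setT mulr1 lerD2r.
      by rewrite ler_piMl.
    + rewrite -(mulr0 C) -(subrr S); apply: cvgMr; apply: cvgB; first exact: cvg_cst.
      exact: eta_sq.
    + by move=> k; exact: Ustep.
apply: filterS => t Ut.
(* Since [w k] is at least [expR (- C * S)], the weight can be removed at the price of a constant
   factor. *)
apply: (@squeeze_cvgr _ _ _ _ (fun=> 0) (fun k => expR (C * S) * U k t)).
- apply: nearW => k; rewrite V0/=.
  have : w k * V k t <= U k t by rewrite lerDl mulr_ge0// subr_ge0.
  rewrite -ler_pdivlMl// => /le_trans; apply; rewrite ler_wpM2r//.
  by rewrite -expRN mulNr opprK ler_expR ler_wpM2l.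
- exact: cvg_cst.
- by rewrite -(mulr0 (expR (C * S))); exact: cvgMr.
Qed.

(** * Square integrable random variables *)

Section square_integrable.
Context {d} {T : measurableType d} {R : realType} (P : probability T R).
Implicit Types (f g : T -> R) (A : set T).

Definition rintegrable f := P.-integrable setT (EFin \o f).

Lemma rintegrableD f g :
  rintegrable f -> rintegrable g -> rintegrable (fun t => f t + g t).
Proof. exact: integrableD. Qed.

Lemma rintegrableZ c f : rintegrable f -> rintegrable (fun t => c * f t).
Proof. exact: integrableZl. Qed.

Lemma rintegrable_cst c : rintegrable (fun=> c).
Proof. exact: finite_measure_integrable_cst. Qed.

Lemma Rintegral_probability_cst c : \int[P]_t c = c.
Proof. by rewrite Rintegral_cst//= probability_setT mulr1. Qed.

Lemma rintegrable_measurable f : rintegrable f -> measurable_fun setT f.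
Proof. by move=> intf; apply/measurable_EFinP; exact: measurable_int intf. Qed.

Lemma rintegrable_le f g : measurable_fun setT f -> rintegrable g ->
  (forall t, `|f t| <= g t) -> rintegrable f.
Proof.
move=> mf intg fg; apply: (le_integrable measurableT _ _ intg) => //.
  exact/measurable_EFinP.
by move=> t _ /=; rewrite lee_fin (le_trans (fg t))// ler_norm.
Qed.

Lemma rintegrable_sum n (f : 'I_n -> T -> R) :
  (forall i, rintegrable (f i)) -> rintegrable (fun t => \sum_i f i t).
Proof.
elim: n f => [|n ih] f intf.
  by under eq_fun do rewrite big_ord0; exact: rintegrable_cst.
by under eq_fun do rewrite big_ord_recl; apply: rintegrableD => //; exact: ih.
Qed.

Lemma Rintegral_sum A n (f : 'I_n -> T -> R) : measurable A ->
  (forall i, rintegrable (f i)) ->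
  \int[P]_(t in A) (\sum_i f i t) = \sum_i \int[P]_(t in A) f i t.
Proof.
move=> mA; elim: n f => [|n ih] f intf.
  under eq_Rintegral do rewrite big_ord0.
  by rewrite big_ord0 Rintegral_cst// mul0r.
under eq_Rintegral do rewrite big_ord_recl.
have subA := integrableS measurableT mA (@subsetT _ A).
have ints : rintegrable (fun t => \sum_i f (lift ord0 i) t).
  by apply: rintegrable_sum => i; exact: intf.
by rewrite big_ord_recl (RintegralD mA (subA _ _ _ (intf ord0)) (subA _ _ _ ints)) ih.
Qed.

Lemma rintegrable_indicM A f :
  measurable A -> rintegrable f -> rintegrable (fun t => \1_A t * f t).
Proof.
move=> mA intf; apply: (@rintegrable_le _ (fun t => `|f t|)).
- by apply: measurable_funM; [exact: measurable_indic|exact: rintegrable_measurable].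
- exact: integrable_norm.
- by move=> t; rewrite normrM ler_piMl// indicE; case: (_ \in _); rewrite ?normr1 ?normr0.
Qed.

Lemma Rintegral_indicM A f : measurable A ->
  \int[P]_(t in A) f t = \int[P]_t (\1_A t * f t).
Proof.
move=> mA; rewrite Rintegral_mkcond; apply: eq_Rintegral => t _.
by rewrite patchE indicE; case: ifPn => _; rewrite ?mul1r ?mul0r.
Qed.

Lemma Rintegral_indic A : measurable A -> \int[P]_t \1_A t = fine (P A).
Proof. by move=> mA; rewrite /Rintegral integral_indic// setIT. Qed.

Definition square_integrable f :=
  measurable_fun setT f /\ rintegrable (fun t => f t ^+ 2).

Lemma square_integrableM f g : square_integrable f -> square_integrable g ->
  rintegrable (fun t => f t * g t).
Proof.
move=> [mf f2] [mg g2]; apply: (rintegrable_le _ (rintegrableD f2 g2)).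
  exact: measurable_funM.
move=> t; rewrite normrM -(real_normK (num_real (f t))) -(real_normK (num_real (g t))).
by have := sqr_ge0 (`|f t| - `|g t|); have : 0 <= `|f t| * `|g t| by []; nra.
Qed.

Lemma square_integrable_cst c : square_integrable (fun=> c).
Proof. by split; [exact: measurable_cst|exact: rintegrable_cst]. Qed.

Lemma square_integrable_rintegrable f : square_integrable f -> rintegrable f.
Proof.
move=> f2; have := square_integrableM (square_integrable_cst 1) f2.
by under eq_fun do rewrite mul1r.
Qed.

Lemma square_integrableD f g : square_integrable f -> square_integrable g ->
  square_integrable (fun t => f t + g t).
Proof.
move=> f2 g2; split; first by apply: measurable_funD; [case: f2|case: g2].
have := rintegrableD (rintegrableD f2.2 g2.2) (rintegrableZ 2 (square_integrableM f2 g2)).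
by congr rintegrable; apply/funext => t; ring.
Qed.

Lemma square_integrableZ c f :
  square_integrable f -> square_integrable (fun t => c * f t).
Proof.
move=> [mf f2]; split; first exact: measurable_funM.
by under eq_fun do rewrite exprMn; exact: rintegrableZ.
Qed.

Lemma square_integrable_sum n (f : 'I_n -> T -> R) :
  (forall i, square_integrable (f i)) -> square_integrable (fun t => \sum_i f i t).
Proof.
elim: n f => [|n ih] f f2.
  by under eq_fun do rewrite big_ord0; exact: square_integrable_cst.
by under eq_fun do rewrite big_ord_recl; apply: square_integrableD => //; exact: ih.
Qed.

Lemma square_integrable_indicM A f : measurable A ->
  square_integrable f -> square_integrable (fun t => \1_A t * f t).
Proof.
move=> mA [mf f2]; split.
  by apply: measurable_funM => //; exact: measurable_indic.
have := rintegrable_indicM mA f2.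
congr rintegrable; apply/funext => t; rewrite exprMn indicE.
by case: (_ \in _); rewrite ?expr1n ?expr0n.
Qed.

Lemma rintegrable_scale_add c f g : rintegrable f -> rintegrable g ->
  rintegrable (fun t => c * f t + g t) /\
  \int[P]_t (c * f t + g t) = c * \int[P]_t f t + \int[P]_t g t.
Proof.
move=> intf intg; have intcf := rintegrableZ c intf.
split; first exact: rintegrableD.
by rewrite (RintegralD measurableT intcf intg) (RintegralZl c measurableT intf).
Qed.

(** One step in one coordinate: [B] is the event that the coordinate is selected, [l] its
    probability, [b] the error, [g] the drift, [xi] the centred noise and [e] the step size. The
    square is expanded with the indicator of [B] equal to its own square; the hypotheses evaluate
    the five resulting terms. *)
Lemma second_moment_update A B (b g xi : T -> R) (e l : R) :
  measurable A -> measurable B ->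
  square_integrable b -> square_integrable g -> square_integrable xi ->
  \int[P]_t (\1_A t * (\1_B t * (b t * xi t))) = 0 ->
  \int[P]_t (\1_A t * (\1_B t * (g t * xi t))) = 0 ->
  \int[P]_t (\1_A t * (\1_B t * xi t ^+ 2)) =
    l * (fine (P A) * \int[P]_t xi t ^+ 2) ->
  \int[P]_t (\1_A t * (\1_B t * (b t * g t))) = l * \int[P]_t (\1_A t * (b t * g t)) ->
  \int[P]_t (\1_A t * (\1_B t * g t ^+ 2)) = l * \int[P]_t (\1_A t * g t ^+ 2) ->
  \int[P]_(t in A) (b t + e * (\1_B t * (xi t - g t))) ^+ 2 =
  \int[P]_(t in A) b t ^+ 2 - 2 * e * l * \int[P]_(t in A) (b t * g t) +
  e ^+ 2 * l * (fine (P A) * \int[P]_t xi t ^+ 2 + \int[P]_(t in A) g t ^+ 2).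
Proof.
move=> mA mB b2 g2 x2 Ebx Egx Ex2 Ebg Egg; rewrite !(Rintegral_indicM _ mA).
have AB f : rintegrable f -> rintegrable (fun t => \1_A t * (\1_B t * f t)).
  by move=> intf; do 2 apply: rintegrable_indicM => //.
have ib := rintegrable_indicM mA b2.2.
have ibx := AB _ (square_integrableM b2 x2).
have igx := AB _ (square_integrableM g2 x2).
have ibg := AB _ (square_integrableM b2 g2).
have ixx := AB _ x2.2.
have igg := AB _ g2.2.
(* The terms of the expansion are added one by one, each time carrying integrability and the value
   of the integral. *)
have [i1 e1] := rintegrable_scale_add (2 * e) ibx ib.
have [i2 e2] := rintegrable_scale_add (- (2 * e)) ibg i1.
have [i3 e3] := rintegrable_scale_add (e ^+ 2) ixx i2.
have [i4 e4] := rintegrable_scale_add (e ^+ 2) igg i3.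
have [_ e5] := rintegrable_scale_add (- (2 * e ^+ 2)) igx i4.
move: e5; rewrite e4 e3 e2 e1 Ebx Egx Ex2 Ebg Egg.
set lhs := Rintegral _ _ _ => e5; transitivity lhs; last by rewrite e5; ring.
apply: eq_Rintegral => t _; rewrite [\1_B t]indicE.
by case: (_ \in _) => /=; ring.
Qed.

End square_integrable.

(** * Transfer of moments between equal laws, and uniform second moment bounds *)

Section moments.
Context {d} {T : measurableType d} {R : realType} (P : probability T R).

Lemma same_law_Rintegral (f g : T -> R) (h : R -> R) :
  measurable_fun setT f -> measurable_fun setT g -> measurable_fun setT h ->
  (forall B, measurable B -> P (f @^-1` B) = P (g @^-1` B)) ->
  rintegrable P (h \o g) ->
  rintegrable P (h \o f) /\ \int[P]_t h (f t) = \int[P]_t h (g t).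
Proof.
move=> mf mg mh fg intg.
pose f' : {mfun T >-> R} := HB.pack f (isMeasurableFun.Build _ _ _ _ _ mf).
pose g' : {mfun T >-> R} := HB.pack g (isMeasurableFun.Build _ _ _ _ _ mg).
have mEh : measurable_fun setT (EFin \o h) by exact/measurable_EFinP.
have dist_fg (q : R -> \bar R) :
    (\int[distribution P f']_x q x = \int[distribution P g']_x q x)%E.
  by apply: eq_measure_integral => B mB _; exact: fg.
have intf : rintegrable P (h \o f).
  apply/integrableP; split.
    by apply/measurable_EFinP; exact: measurableT_comp.
  have /integrableP[_] := intg; apply: le_lt_trans.
  have mah : measurable_fun setT (abse \o (EFin \o h)) by exact: measurableT_comp.
  have ah0 y : (0 <= (abse \o (EFin \o h)) y)%E by exact: abse_ge0.
  have Ef := ge0_integral_distribution f' mah ah0.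
  have Eg := ge0_integral_distribution g' mah ah0.
  rewrite le_eqVlt; apply/orP; left; apply/eqP.
  exact: etrans (esym (Ef P)) (etrans (dist_fg _) (Eg P)).
split=> //; rewrite /Rintegral; congr fine.
have <- := integral_distribution mEh (intg : P.-integrable setT ((EFin \o h) \o g')).
have <- := integral_distribution mEh (intf : P.-integrable setT ((EFin \o h) \o f')).
exact: dist_fg.
Qed.

(** The bound does not depend on [k], because one noise constant must serve at all times. *)
Definition bounded_second_moments (f : nat -> T -> R) :=
  (forall k, square_integrable P (f k)) /\
  exists s, forall k, \int[P]_t f k t ^+ 2 <= s.

Lemma bounded_second_momentsD (f g : nat -> T -> R) :
  bounded_second_moments f -> bounded_second_moments g ->
  bounded_second_moments (fun k t => f k t + g k t).
Proof.
move=> [f2 [s fs]] [g2 [r gr]]; split=> [k|]; first exact: square_integrableD.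
exists (2 * s + 2 * r) => k.
have [int1 e1] := rintegrable_scale_add 2 (f2 k).2 (rintegrableZ 2 (g2 k).2).
apply: (@le_trans _ _ (\int[P]_t (2 * f k t ^+ 2 + 2 * g k t ^+ 2))).
  apply: le_Rintegral => //; first by case: (square_integrableD (f2 k) (g2 k)).
  by move=> t _; have := sqr_ge0 (f k t - g k t); nra.
rewrite e1 (RintegralZl 2 measurableT (g2 k).2).
by have := fs k; have := gr k; lra.
Qed.

Lemma bounded_second_momentsZ c (f : nat -> T -> R) :
  bounded_second_moments f -> bounded_second_moments (fun k t => c * f k t).
Proof.
move=> [f2 [s fs]]; split=> [k|]; first exact: square_integrableZ.
exists (c ^+ 2 * s) => k; under eq_Rintegral do rewrite exprMn.
by rewrite (RintegralZl (c ^+ 2) measurableT (f2 k).2) ler_wpM2l// sqr_ge0.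
Qed.

Lemma bounded_second_moments_cst c : bounded_second_moments (fun _ _ => c).
Proof.
split=> [k|]; first exact: square_integrable_cst.
by exists (\int[P]_t c ^+ 2).
Qed.

Lemma bounded_second_moments_sum n (f : 'I_n -> nat -> T -> R) :
  (forall i, bounded_second_moments (f i)) ->
  bounded_second_moments (fun k t => \sum_i f i k t).
Proof.
elim: n f => [|n ih] f fb.
  under eq_fun do under eq_fun do rewrite big_ord0.
  exact: bounded_second_moments_cst.
under eq_fun do under eq_fun do rewrite big_ord_recl.
by apply: bounded_second_momentsD => //; exact: ih.
Qed.

End moments.

(** * Functions measurable for a generated sigma-algebra *)

Section adapted.
Context {d} {T : measurableType d} {R : realType}.
Implicit Types (G : set_system T) (f : T -> R).

(** Retyping the domain as [g_sigma_algebraType G] lets the closure lemmas for [measurable_fun]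
    apply to the generated sub-sigma-algebra. *)
Definition adapted G f :=
  measurable_fun setT (f : g_sigma_algebraType G -> R).

Lemma adapted_preimage G f B : adapted G f -> measurable B -> <<s G >> (f @^-1` B).
Proof. by move=> Gf mB; rewrite -[X in <<s G >> X]setTI; exact: Gf. Qed.

Lemma adaptedP G f :
  (forall B, measurable B -> <<s G >> (f @^-1` B)) -> adapted G f.
Proof. by move=> Gf _ B mB; rewrite setTI; exact: Gf. Qed.

Lemma adaptedS G G' f : G `<=` G' -> adapted G f -> adapted G' f.
Proof.
move=> GG' Gf; apply: adaptedP => B mB; apply: (sub_sigma_algebra2 GG').
exact: adapted_preimage.
Qed.

Lemma adapted_indic G A : <<s G >> A -> adapted G (\1_A : T -> R).
Proof. exact: (@measurable_indic _ (g_sigma_algebraType G)). Qed.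

Lemma adapted_setI_lt G A f r : adapted G f -> <<s G >> A ->
  <<s G >> (A `&` [set t | f t < r]).
Proof.
move=> Gf GA; apply: (@measurableI _ (g_sigma_algebraType G)) => //.
have -> : [set t | f t < r] = f @^-1` `]-oo, r[%classic.
  by apply/seteqP; split => t /=; rewrite in_itv.
by apply: adapted_preimage => //; exact: measurable_itv.
Qed.

Context (P : probability T R) (I : choiceType) (F : I -> set_system T).
Hypotheses (Fm : forall i, F i `<=` measurable) (FT : forall i, F i setT)
  (FI : forall i, setI_closed (F i)) (indF : mutually_independent P F).

Lemma generated_measurable (S : set I) :
  <<s \bigcup_(i in S) F i >> `<=` measurable.
Proof.
apply: smallest_sub; first exact: sigma_algebra_measurable.
by move=> A [i _]; exact: Fm.
Qed.

Lemma independent_adaptedM (S1 S2 : set I) f g : [disjoint S1 & S2] ->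
  adapted (\bigcup_(i in S1) F i) f -> adapted (\bigcup_(i in S2) F i) g ->
  rintegrable P f -> rintegrable P g ->
  rintegrable P (fun t => f t * g t) /\
  \int[P]_t (f t * g t) = \int[P]_t f t * \int[P]_t g t.
Proof.
move=> S12 fS1 gS2; apply: independent_integrableM => A B mA mB.
by apply: (mutually_independent_generated Fm FT FI S12 indF);
  exact: adapted_preimage.
Qed.

(** Two applications of the product formula: [f] against the indicator of [B], then their product,
    adapted to the block [S1] united with [S2], against [g]. *)
Lemma independent_adapted_indicM (S1 S2 S3 : set I) f g B :
  [disjoint S1 & S2] -> [disjoint S1 `|` S2 & S3] ->
  adapted (\bigcup_(i in S1) F i) f -> <<s \bigcup_(i in S2) F i >> B ->
  adapted (\bigcup_(i in S3) F i) g -> rintegrable P f -> rintegrable P g ->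
  \int[P]_t (f t * (\1_B t * g t)) =
  fine (P B) * (\int[P]_t f t * \int[P]_t g t).
Proof.
move=> S12 S123 fS1 BS2 gS3 intf intg.
have mB := generated_measurable BS2.
have intB : rintegrable P (\1_B : T -> R).
  by have := rintegrable_indicM mB (rintegrable_cst P 1); under eq_fun do rewrite mulr1.
have [intfB EfB] := independent_adaptedM S12 fS1 (adapted_indic BS2) intf intB.
have fBS : adapted (\bigcup_(i in S1 `|` S2) F i) (fun t => f t * \1_B t).
  apply: measurable_funM.
    by apply: adaptedS fS1; exact: bigcup_subset (@subsetUl _ _ _).
  by apply: adaptedS (adapted_indic BS2); exact: bigcup_subset (@subsetUr _ _ _).
have [_ E] := independent_adaptedM S123 fBS gS3 intfB intg.
under eq_Rintegral do rewrite mulrA.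
by rewrite E EfB Rintegral_indic//; ring.
Qed.

End adapted.

(** * Gram matrices *)

Section linear_bounds.
Context {R : realType}.

(** Both sides become double sums, compared termwise by a_i a_j <= (a_i^2 + a_j^2) / 2. *)
Lemma sqr_sum_le n (a : 'I_n -> R) : (\sum_i a i) ^+ 2 <= n%:R * \sum_i a i ^+ 2.
Proof.
have -> : (\sum_i a i) ^+ 2 = \sum_i \sum_j a i * a j.
  by rewrite expr2 mulr_suml; apply: eq_bigr => i _; rewrite mulr_sumr.
have -> : n%:R * (\sum_i a i ^+ 2) = \sum_i \sum_j (a i ^+ 2 + a j ^+ 2) / 2.
  transitivity (\sum_(i < n) (n%:R * a i ^+ 2 + \sum_j a j ^+ 2) / 2).
    rewrite -mulr_suml big_split /= -mulr_sumr sumr_const card_ord -mulr_natl.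
    by field.
  apply: eq_bigr => i _; rewrite -mulr_suml big_split /= sumr_const card_ord.
  by rewrite mulr_natl.
apply: ler_sum => i _; apply: ler_sum => j _.
by have := sqr_ge0 (a i - a j); lra.
Qed.

Lemma mulmx_sqr_bound p q (M : 'M[R]_(p, q)) :
  exists2 C, 0 < C & forall v : 'cV[R]_q,
    \sum_i (M *m v) i 0 ^+ 2 <= C * \sum_j v j 0 ^+ 2.
Proof.
(* A multiple of the squared Frobenius norm; the added 1 keeps the constant positive when [M] is
   zero. *)
exists (1 + \sum_(i < p) \sum_(j < q) q%:R * M i j ^+ 2).
  by rewrite ltr_pwDl// sumr_ge0// => i _; rewrite sumr_ge0// => j _; rewrite mulr_ge0// sqr_ge0.
move=> v; have v0 : 0 <= \sum_j v j 0 ^+ 2 by apply: sumr_ge0 => j _; exact: sqr_ge0.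
rewrite mulrDl mul1r -[leLHS]add0r lerD// mulr_suml; apply: ler_sum => i _.
rewrite mxE; apply: le_trans (sqr_sum_le _) _.
rewrite mulr_sumr mulr_suml; apply: ler_sum => j _; rewrite exprMn mulrA.
rewrite ler_wpM2l ?(mulr_ge0 (ler0n _ _) (sqr_ge0 _))//.
by rewrite (bigD1 j)//= lerDl sumr_ge0// => l _; exact: sqr_ge0.
Qed.

Lemma sum_sqr_eq0 n (v : 'rV[R]_n) : \sum_j v 0 j ^+ 2 = 0 -> v = 0.
Proof.
move=> /psumr_eq0P => v0; apply/rowP => j; rewrite mxE.
by apply/eqP; rewrite -sqrf_eq0 v0// => i _; exact: sqr_ge0.
Qed.

(** If v A A' = 0 then |v A|^2 = v A A' v' = 0, so v A = 0, and v = 0 because the rows of [A] are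
    independent. *)
Lemma gram_unitmx m n (A : 'M[R]_(m, n)) : \rank A = m -> A *m A^T \in unitmx.
Proof.
move=> rA; have fA : row_free A by rewrite /row_free rA.
rewrite -row_free_unit; apply: inj_row_free => v vG.
apply: (row_free_inj fA); rewrite mul0mx; apply: sum_sqr_eq0.
transitivity ((v *m (A *m A^T) *m v^T) 0 0); last by rewrite vG mul0mx mxE.
rewrite mulmxA -mulmxA -trmx_mul mxE; apply: eq_bigr => j _.
by rewrite [_^T _ _]mxE expr2.
Qed.

(** Quantitative positive definiteness of G = A A' without eigenvalues: v = (G^-1 A)(A' v), so |v|^2
    <= C |A' v|^2 = C <v, G v>. *)
Lemma gram_lower_bound m n (A : 'M[R]_(m, n)) : \rank A = m ->
  exists2 C, 0 < C & forall v : 'cV[R]_m,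
    \sum_i v i 0 ^+ 2 <= C * \sum_i v i 0 * (A *m A^T *m v) i 0.
Proof.
move=> rA; have [C C0 CP] := mulmx_sqr_bound (invmx (A *m A^T) *m A).
exists C => // v; have := CP (A^T *m v).
rewrite -[invmx _ *m A *m _]mulmxA [A *m (_ *m _)]mulmxA mulKmx ?gram_unitmx//.
suff -> : \sum_j (A^T *m v) j 0 ^+ 2 = \sum_i v i 0 * (A *m A^T *m v) i 0 by [].
transitivity (((A^T *m v)^T *m (A^T *m v)) 0 0).
  by rewrite mxE; apply: eq_bigr => j _; rewrite [_^T _ _]mxE expr2.
have -> : (A^T *m v)^T *m (A^T *m v) = v^T *m (A *m A^T *m v).
  by rewrite trmx_mul trmxK !mulmxA.
by rewrite mxE; apply: eq_bigr => i _; rewrite [_^T _ _]mxE.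
Qed.

Lemma cvg_col n (f : nat -> 'cV[R]_n) (l : 'cV[R]_n) :
  (forall i, (fun k => f k i 0) @ \oo --> l i 0) -> f @ \oo --> l.
Proof.
move=> fl; apply/cvgrPdist_lt => e e0; near=> k.
rewrite /Num.norm/= mx_normrE; apply/bigmax_ltP; split => // -[i j] _ /=.
rewrite !mxE (ord1 j); move: i {j}; near: k.
suff : \forall k \near \oo, forall i, true -> `|l i 0 - f k i 0| < e.
  by apply: filterS => k h i; exact: h.
apply: filter_forall => i; have /cvgrPdist_lt/(_ _ e0) := fl i.
by apply: filterS => k h _.
Unshelve. all: by end_near. Qed.

End linear_bounds.

(** * The Kaczmarz iteration *)

Lemma vec_measurable_coord {R : realType} n (i : 'I_n) (B : set R) :
  measurable B -> vec_measurable [set v : 'cV[R]_n | B (v i 0)].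
Proof. by move=> mB; apply: sub_sigma_algebra; exists i, B. Qed.

Lemma vec_measurableT {R : realType} n : vec_measurable [set: 'cV[R]_n].
Proof. exact: (@measurableT _ (g_sigma_algebraType _)). Qed.

Lemma vec_measurableI {R : realType} n (A B : set 'cV[R]_n) :
  vec_measurable A -> vec_measurable B -> vec_measurable (A `&` B).
Proof. exact: (@measurableI _ (g_sigma_algebraType _)). Qed.

Lemma random_vector_coord {d} {T : measurableType d} {R : realType} n
    (f : T -> 'cV[R]_n) i :
  random_vector f -> measurable_fun setT (fun t => f t i 0).
Proof.
by move=> rf _ B mB; rewrite setTI; exact: rf (vec_measurable_coord i mB).
Qed.

Lemma sigma_vec_coord {d} {T : measurableType d} {R : realType} n
    (f : T -> 'cV[R]_n) i (G : set_system T) :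
  sigma_vec f `<=` G -> adapted G (fun t => f t i 0).
Proof.
move=> fG; apply: adaptedP => B mB; apply: sub_sigma_algebra; apply: fG.
by exists [set v | B (v i 0)]; split => //; exact: vec_measurable_coord.
Qed.

Section coordinate_moments.
Context {d} {T : measurableType d} {R : realType} (P : probability T R) (n : nat).
Context (X : T -> 'cV[R]_n) (Xs : nat -> T -> 'cV[R]_n).
Hypotheses (hX : random_vector X) (hXs : forall k, random_vector (Xs k))
  (hX2 : rintegrable P (fun t => \sum_i X t i 0 ^+ 2))
  (hXlaw : forall k, same_law_vec P (Xs k) X).

Lemma square_integrable_coord i : square_integrable P (fun t => X t i 0).
Proof.
have mX := random_vector_coord i hX; split=> //.
apply: rintegrable_le hX2 _; first exact: measurable_funX.
move=> t; rewrite ger0_norm ?sqr_ge0// (bigD1 i)//= lerDl sumr_ge0// => j _.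
exact: sqr_ge0.
Qed.

Let law i k (B : set R) : measurable B ->
  P ((fun t => Xs k t i 0) @^-1` B) = P ((fun t => X t i 0) @^-1` B).
Proof. by move=> mB; exact: hXlaw (vec_measurable_coord i mB). Qed.

Lemma Rintegral_coord i k : \int[P]_t Xs k t i 0 = \int[P]_t X t i 0.
Proof.
have [] // := @same_law_Rintegral _ _ _ P _ _ idfun (random_vector_coord i (hXs k))
  (random_vector_coord i hX) (@measurable_id _ _ _) (law i k)
  (square_integrable_rintegrable (square_integrable_coord i)).
Qed.

Lemma bounded_second_moments_coord i :
  bounded_second_moments P (fun k t => Xs k t i 0).
Proof.
have sq k := same_law_Rintegral (random_vector_coord i (hXs k))
  (random_vector_coord i hX) (exprn_measurable 2) (law i k)
  (square_integrable_coord i).2.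
split=> [k|]; first by split; [exact: random_vector_coord|have [] := sq k].
by exists (\int[P]_t X t i 0 ^+ 2) => k; have [_ ->] := sq k.
Qed.

End coordinate_moments.

(** The recursion for the error. As G [alphas] = EY - A x0, the residual A (x0 + A' a) - EY equals G
    (a - [alphas]). *)
Lemma kaczmarz_alphaS {R : realType} m N (A : 'M[R]_(m, N)) x0 (eta : nat -> R)
    Ys z k i (EY : 'cV[R]_m) (alphas := invmx (A *m A^T) *m (EY - A *m x0))
    (a := kaczmarz_alpha A x0 eta Ys z) : \rank A = m ->
  a k.+1 i 0 - alphas i 0 = (a k i 0 - alphas i 0) +
    eta k * ((i == z k)%:R *
      ((Ys k i 0 - EY i 0) - \sum_j (A *m A^T) i j * (a k j 0 - alphas j 0))).
Proof.
move=> rA.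
have -> : \sum_j (A *m A^T) i j * (a k j 0 - alphas j 0) =
    (A *m (x0 + A^T *m a k)) i 0 - EY i 0.
  transitivity ((A *m A^T *m (a k - alphas)) i 0).
    by rewrite mxE; apply: eq_bigr => j _; rewrite !mxE.
  rewrite mulmxBr /alphas mulKVmx ?gram_unitmx// mulmxDr mulmxA.
  by rewrite !mxE; ring.
have -> : a k.+1 i 0 = a k i 0 + eta k *
    ((i == z k)%:R * (Ys k i 0 - (A *m (x0 + A^T *m a k)) i 0)).
  rewrite /a /= -/(a k) !mxE; congr (_ + _ * _).
  (* On the selected coordinate the matrix unit extracts one entry of the residual; elsewhere both
     bracketed terms vanish. *)
  case: (eqVneq i (z k)) => [<-|ne].
    rewrite mul1r; congr (_ - _); rewrite (bigD1 i)//= big1 => [|j ji].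
      by rewrite !mxE !eqxx mul1r addr0.
    by rewrite !mxE (negbTE ji) andbF mul0r.
  by rewrite mul0r big1 ?subrr// => j _; rewrite !mxE (negbTE ne) mul0r.
by rewrite /alphas; ring.
Qed.

Section kaczmarz.
Context {R : realType} {d} {T : measurableType d} (P : probability T R).
Context (m N : nat) (A : 'M[R]_(m, N)) (X : T -> 'cV[R]_N) (W : T -> 'cV[R]_m)
  (Z : T -> 'I_m) (lam : 'I_m -> R) (Xs : nat -> T -> 'cV[R]_N)
  (Ws : nat -> T -> 'cV[R]_m) (Zs : nat -> T -> 'I_m) (eta : nat -> R)
  (x0 : 'cV[R]_N).
Hypotheses (hArank : \rank A = m) (hX : random_vector X) (hW : random_vector W)
  (hX2 : rintegrable P (fun t => \sum_i X t i 0 ^+ 2))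
  (hW2 : rintegrable P (fun t => \sum_i W t i 0 ^+ 2))
  (hlam : forall i, P (Z @^-1` [set i]) = (lam i)%:E /\ 0 < lam i)
  (hXs : forall k, random_vector (Xs k)) (hWs : forall k, random_vector (Ws k))
  (hZs : forall k, random_index (Zs k))
  (hXlaw : forall k, same_law_vec P (Xs k) X)
  (hWlaw : forall k, same_law_vec P (Ws k) W)
  (hZlaw : forall k, same_law_index P (Zs k) Z).

Let F (j : (nat + nat) + nat) : set_system T :=
  match j with
  | inl (inl k) => sigma_vec (Xs k)
  | inl (inr k) => sigma_vec (Ws k)
  | inr k => sigma_index (Zs k)
  end.
Hypothesis hindep : mutually_independent P F.

(** The strict inequality matches the 0-indexed samples: [alpha k] depends on those of index below
    [k], and index [k] is the fresh sample of the next step. *)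
Let past k : set ((nat + nat) + nat) :=
  [set j | match j with inl (inl i) | inl (inr i) | inr i => (i < k)%N end].

Let Fm j : F j `<=` measurable.
Proof.
case: j => [[k|k]|k] E /=; [move=> [S [mS ->]]|move=> [S [mS ->]]|move=> [S ->]].
- exact: hXs.
- exact: hWs.
- exact: hZs.
Qed.

Let FT j : F j setT.
Proof.
by case: j => [[k|k]|k]; exists setT; split => //; exact: vec_measurableT.
Qed.

Let FI j : setI_closed (F j).
Proof.
case: j => [[k|k]|k] A1 A2 /=.
- move=> [B1 [m1 ->]] [B2 [m2 ->]].
  by exists (B1 `&` B2); split => //; exact: vec_measurableI.
- move=> [B1 [m1 ->]] [B2 [m2 ->]].
  by exists (B1 `&` B2); split => //; exact: vec_measurableI.
- by move=> [B1 ->] [B2 ->]; exists (B1 `&` B2).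
Qed.

Let Y k t := A *m Xs k t + Ws k t.
Let EY := \col_i fine ('E_P[(fun t => (A *m X t + W t) i 0)%R]).
Let alphas := invmx (A *m A^T) *m (EY - A *m x0).
Let alpha k t := kaczmarz_alpha A x0 eta (Y ^~ t) (Zs ^~ t) k.
Let beta k i t := alpha k t i 0 - alphas i 0.
Let Gbeta k i t := \sum_j (A *m A^T) i j * beta k j t.
Let xi k i t := Y k t i 0 - EY i 0.

Let coord_sum (x : T -> 'cV[R]_N) (w : T -> 'cV[R]_m) i t :
  (A *m x t + w t) i 0 = \sum_l A i l * x t l 0 + w t i 0.
Proof. by rewrite !mxE. Qed.

Let beta0 i : beta 0 i = fun=> 0 - alphas i 0.
Proof. by apply/funext => t; rewrite /beta /alpha /= mxE. Qed.

Let betaS k i t : beta k.+1 i t =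
  beta k i t + eta k * (\1_(Zs k @^-1` [set i]) t * (xi k i t - Gbeta k i t)).
Proof.
rewrite /beta /alpha kaczmarz_alphaS// indicE.
suff -> : (i == Zs k t) = (t \in Zs k @^-1` [set i]) by [].
by apply/eqP/idP => [->|/set_mem /= ->//]; exact: mem_set.
Qed.

Let xi_adapted k i S : S (inl (inl k)) -> S (inl (inr k)) ->
  adapted (\bigcup_(j in S) F j) (xi k i).
Proof.
move=> SX SW; apply: measurable_funB; last exact: measurable_cst.
rewrite [X in measurable_fun _ X](_ : _ =
    fun t => \sum_l A i l * Xs k t l 0 + Ws k t i 0); last first.
  by apply/funext => t; exact: coord_sum.
apply: measurable_funD.
  apply: measurable_sum => l; apply: measurable_funM; first exact: measurable_cst.
  by apply: sigma_vec_coord; exact: (bigcup_sup (i := inl (inl k))).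
by apply: sigma_vec_coord; exact: (bigcup_sup (i := inl (inr k))).
Qed.

Let Zs_generated k i S : S (inr k) ->
  <<s \bigcup_(j in S) F j >> (Zs k @^-1` [set i]).
Proof.
by move=> SZ; apply: sub_sigma_algebra; exists (inr k) => //; exists [set i].
Qed.

(** Stating this for any [S] containing the past keeps one sigma-algebra throughout the induction on
    [k]. *)
Let beta_adapted S k i : past k `<=` S -> adapted (\bigcup_(j in S) F j) (beta k i).
Proof.
elim: k i => [|k ih] i kS; first by rewrite beta0; exact: measurable_cst.
have ih' j : adapted (\bigcup_(j in S) F j) (beta k j).
  apply: ih => j' pj; apply: kS; move: j' pj => [[l|l]|l] /=; exact: ltnW.
have -> : beta k.+1 i = fun t => beta k i t +
    eta k * (\1_(Zs k @^-1` [set i]) t * (xi k i t - Gbeta k i t)).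
  by apply/funext => t; exact: betaS.
apply: measurable_funD; first exact: ih'.
apply: measurable_funM; first exact: measurable_cst.
apply: measurable_funM.
  by apply: adapted_indic; apply: Zs_generated; apply: kS => /=.
apply: measurable_funB; first by apply: xi_adapted; apply: kS => /=.
apply: measurable_sum => j.
by apply: measurable_funM; [exact: measurable_cst|exact: ih'].
Qed.

Let Gbeta_adapted S k i : past k `<=` S -> adapted (\bigcup_(j in S) F j) (Gbeta k i).
Proof.
move=> kS; apply: measurable_sum => j.
by apply: measurable_funM; [exact: measurable_cst|exact: beta_adapted].
Qed.

Let xi_bounded i : bounded_second_moments P (fun k => xi k i).
Proof.
apply: (bounded_second_momentsD (g := fun _ _ => - EY i 0)); last first.
  exact: bounded_second_moments_cst.
rewrite (_ : (fun k t => Y k t i 0) =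
    fun k t => \sum_l A i l * Xs k t l 0 + Ws k t i 0); last first.
  by apply/funext => k; apply/funext => t; exact: coord_sum.
apply: bounded_second_momentsD; last exact: bounded_second_moments_coord hW2 hWlaw i.
apply: bounded_second_moments_sum => l; apply: bounded_second_momentsZ.
exact: bounded_second_moments_coord hX2 hXlaw l.
Qed.

(** Linearity splits the means of [Y k] and of A X + W into coordinate means, which agree by
    equality of the laws. *)
Let Rintegral_xi k i : \int[P]_t xi k i t = 0.
Proof.
have affine (x : T -> 'cV[R]_N) (w : T -> 'cV[R]_m) :
    (forall l, rintegrable P (fun t => x t l 0)) ->
    rintegrable P (fun t => w t i 0) ->
    rintegrable P (fun t => (A *m x t + w t) i 0) /\
    \int[P]_t (A *m x t + w t) i 0 =
    \sum_l A i l * \int[P]_t x t l 0 + \int[P]_t w t i 0.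
  move=> ix iw; under eq_fun do rewrite coord_sum.
  have iAx l : rintegrable P (fun t => A i l * x t l 0) by exact: rintegrableZ.
  have isum := rintegrable_sum iAx.
  split; first exact: rintegrableD.
  rewrite (RintegralD measurableT isum iw) (Rintegral_sum measurableT iAx).
  by congr (_ + _); apply: eq_bigr => l _; rewrite (RintegralZl _ measurableT (ix l)).
have ia (f : T -> R) := @square_integrable_rintegrable _ _ _ P f.
have [_ EX] := affine X W (fun l => ia _ (square_integrable_coord hX hX2 l))
  (ia _ (square_integrable_coord hW hW2 i)).
have [iY EYk] := affine (Xs k) (Ws k)
  (fun l => ia _ ((bounded_second_moments_coord hX hXs hX2 hXlaw l).1 k))
  (ia _ ((bounded_second_moments_coord hW hWs hW2 hWlaw i).1 k)).
rewrite (RintegralB measurableT iY (rintegrable_cst P (EY i 0))).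
rewrite Rintegral_probability_cst EYk.
have -> : EY i 0 = \int[P]_t (A *m X t + W t) i 0 by rewrite /EY mxE unlock.
rewrite EX.
apply/eqP; rewrite subr_eq0; apply/eqP; congr (_ + _).
  by apply: eq_bigr => l _; rewrite (Rintegral_coord hX hXs hX2 hXlaw).
exact: Rintegral_coord hW hWs hW2 hWlaw _ _.
Qed.

Let beta_square_integrable k i : square_integrable P (beta k i).
Proof.
elim: k i => [|k ih] i; first by rewrite beta0; exact: square_integrable_cst.
have -> : beta k.+1 i = fun t => beta k i t +
    eta k * (\1_(Zs k @^-1` [set i]) t * (xi k i t + -1 * Gbeta k i t)).
  by apply/funext => t; rewrite betaS mulN1r.
apply: square_integrableD => //; apply: square_integrableZ.
apply: square_integrable_indicM; first exact: hZs.
apply: square_integrableD; first exact: (xi_bounded i).1.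
apply: square_integrableZ; apply: square_integrable_sum => j.
exact: square_integrableZ.
Qed.

Let Gbeta_square_integrable k i : square_integrable P (Gbeta k i).
Proof.
apply: square_integrable_sum => j; apply: square_integrableZ.
exact: beta_square_integrable.
Qed.

(** The past, the index [Zs k] and the pair [Xs k], [Ws k] are three disjoint blocks. Taking for [h]
    the noise, its square or the constant 1 yields all the hypotheses of [second_moment_update]. *)
Let Rintegral_independent k i f h B : <<s \bigcup_(j in past k) F j >> B ->
  adapted (\bigcup_(j in past k) F j) f -> rintegrable P f ->
  adapted (\bigcup_(j in [set inl (inl k); inl (inr k)]) F j) h -> rintegrable P h ->
  \int[P]_t (\1_B t * (\1_(Zs k @^-1` [set i]) t * (f t * h t))) =
  lam i * (\int[P]_t (\1_B t * f t) * \int[P]_t h t).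
Proof.
move=> pB pf intf ph inth.
have -> : lam i = fine (P (Zs k @^-1` [set i])) by rewrite hZlaw (hlam i).1.
have mB : measurable B by exact: generated_measurable Fm _ _ pB.
rewrite -(@independent_adapted_indicM _ _ _ P _ F Fm FT FI hindep (past k)
  [set inr k] [set inl (inl k); inl (inr k)]).
- by apply: eq_Rintegral => t _; ring.
- by apply/disj_setPS => j [] /= + jE; rewrite jE /= ltnn.
- by apply/disj_setPS => j [] /= [lk|->] [] // jE; move: lk; rewrite jE /= ltnn.
- by apply: measurable_funM => //; exact: adapted_indic.
- exact: Zs_generated.
- by [].
- exact: rintegrable_indicM.
- by [].
Qed.

Let V k t := \sum_i (lam i)^-1 * beta k i t ^+ 2.

Let lam0 i : 0 < lam i. Proof. exact: (hlam i).2. Qed.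

Let V_ge0 k t : 0 <= V k t.
Proof.
by apply: sumr_ge0 => i _; rewrite mulr_ge0 ?sqr_ge0// invr_ge0 ltW.
Qed.

Let V_rintegrable k : rintegrable P (V k).
Proof.
apply: rintegrable_sum => i; apply: rintegrableZ.
exact: (beta_square_integrable k i).2.
Qed.

Let V_step_identity k B : <<s \bigcup_(j in past k) F j >> B ->
  \int[P]_(t in B) V k.+1 t = \int[P]_(t in B) V k t -
  2 * eta k * \int[P]_(t in B) (\sum_i beta k i t * Gbeta k i t) +
  eta k ^+ 2 * (fine (P B) * \sum_i \int[P]_t xi k i t ^+ 2 +
                \int[P]_(t in B) (\sum_i Gbeta k i t ^+ 2)).
Proof.
move=> pB; have mB : measurable B by exact: generated_measurable Fm _ _ pB.
have b2 := beta_square_integrable k; have g2 := Gbeta_square_integrable k.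
have x2 i := (xi_bounded i).1 k.
have subB f : rintegrable P f -> P.-integrable B (EFin \o f).
  exact: integrableS measurableT mB (@subsetT _ B).
have IV l : \int[P]_(t in B) V l t =
    \sum_i (lam i)^-1 * \int[P]_(t in B) beta l i t ^+ 2.
  have bl i := (beta_square_integrable l i).2.
  rewrite (Rintegral_sum mB (fun i => rintegrableZ _ (bl i))).
  by apply: eq_bigr => i _; rewrite (RintegralZl _ mB (subB _ (bl i))).
rewrite !IV (Rintegral_sum mB (fun i => square_integrableM (b2 i) (g2 i))).
rewrite (Rintegral_sum mB (fun i => (g2 i).2)).
rewrite [fine (P B) * _]mulr_sumr -big_split /= [eta k ^+ 2 * _]mulr_sumr.
rewrite [2 * eta k * _]mulr_sumr -sumrB -big_split /=.
apply: eq_bigr => i _.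
have -> : \int[P]_(t in B) beta k.+1 i t ^+ 2 = \int[P]_(t in B) (beta k i t +
    eta k * (\1_(Zs k @^-1` [set i]) t * (xi k i t - Gbeta k i t))) ^+ 2.
  by apply: eq_Rintegral => t _; rewrite betaS.
have ab := beta_adapted i (@subset_refl _ (past k)).
have ag := Gbeta_adapted i (@subset_refl _ (past k)).
have ax : adapted (\bigcup_(j in [set inl (inl k); inl (inr k)]) F j) (xi k i).
  by apply: xi_adapted; [left|right].
have a1 : adapted (\bigcup_(j in [set inl (inl k); inl (inr k)]) F j) (fun=> 1 : R).
  exact: measurable_cst.
have i1 := rintegrable_cst P 1.
have ix := square_integrable_rintegrable (x2 i).
rewrite (@second_moment_update _ _ _ P _ _ _ _ _ _ (lam i) mB _ (b2 i) (g2 i) (x2 i)).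
(* The weight 1 / [lam i] cancels the selection probability, so the coordinates sum to unweighted
   forms. *)
- by have := lam0 i; move=> /lt0r_neq0 l0; field.
- exact: hZs.
- by rewrite (Rintegral_independent i pB ab (square_integrable_rintegrable (b2 i)) ax ix)
    Rintegral_xi !mulr0.
- by rewrite (Rintegral_independent i pB ag (square_integrable_rintegrable (g2 i)) ax ix)
    Rintegral_xi !mulr0.
- have ap1 : adapted (\bigcup_(j in past k) F j) (fun=> 1 : R).
    exact: measurable_cst.
  have := Rintegral_independent i pB ap1 i1 (measurable_funX 2 ax) (x2 i).2.
  rewrite -Rintegral_indic// (_ : \int[P]_t (\1_B t * 1) = \int[P]_t \1_B t).
    by under eq_Rintegral do rewrite mul1r.
  by apply: eq_Rintegral => t _; rewrite mulr1.
- have := Rintegral_independent i pB (measurable_funM ab ag)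
    (square_integrableM (b2 i) (g2 i)) a1 i1.
  by rewrite Rintegral_probability_cst mulr1; under eq_Rintegral do rewrite mulr1.
- have := Rintegral_independent i pB (measurable_funX 2 ag) (g2 i).2 a1 i1.
  by rewrite Rintegral_probability_cst mulr1; under eq_Rintegral do rewrite mulr1.
Qed.

Lemma kaczmarz_alpha_cvg : (forall k, 0 < eta k) -> series eta @ \oo --> +oo ->
  cvgn (series (fun k => eta k ^+ 2)) ->
  {ae P, forall t, alpha ^~ t @ \oo --> alphas}.
Proof.
move=> eta0 eta_oo eta_sq.
have lam_le1 i : lam i <= 1.
  have := hZlaw 0 [set i]; rewrite (hlam i).1 => lamE.
  by rewrite -lee_fin -lamE probability_le1//; exact: hZs.
have [C1 C10 C1P] := mulmx_sqr_bound (A *m A^T).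
have [C2 C20 C2P] := gram_lower_bound hArank.
(* [L] dominates every weight, which makes [V] comparable with the squared norm of the error. *)
pose L := 1 + \sum_i (lam i)^-1.
have L0 : 0 < L by rewrite ltr_pwDl// sumr_ge0// => i _; rewrite invr_ge0 ltW.
have sq_V k t : \sum_i beta k i t ^+ 2 <= V k t.
  apply: ler_sum => i _; rewrite ler_peMl ?sqr_ge0//.
  by rewrite invf_ge1.
have V_sq k t : V k t <= L * \sum_i beta k i t ^+ 2.
  rewrite mulr_sumr; apply: ler_sum => i _; rewrite ler_wpM2r ?sqr_ge0//.
  rewrite /L (bigD1 i)//= addrCA lerDl addr_ge0// sumr_ge0// => j _.
  by rewrite invr_ge0 ltW.
pose bvec k t : 'cV[R]_m := \col_i beta k i t.
have GE k t i : (A *m A^T *m bvec k t) i 0 = Gbeta k i t.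
  by rewrite mxE; apply: eq_bigr => j _; rewrite [bvec _ _ _ _]mxE.
have bE k t i : bvec k t i 0 = beta k i t by rewrite mxE.
have G_up k t : \sum_i Gbeta k i t ^+ 2 <= C1 * V k t.
  have := C1P (bvec k t); under eq_bigr do rewrite GE.
  under [X in _ <= _ * X]eq_bigr do rewrite bE.
  by move=> /le_trans; apply; rewrite ler_wpM2l// ltW.
have G_low k t : (L * C2)^-1 * V k t <= \sum_i beta k i t * Gbeta k i t.
  rewrite mulrC ler_pdivrMr ?mulr_gt0// (le_trans (V_sq k t))//.
  rewrite mulrCA ler_pM2l// mulrC.
  have := C2P (bvec k t); under eq_bigr do rewrite bE.
  by under [X in _ <= _ * X]eq_bigr do rewrite bE GE.
have [s sP] : exists s, forall k, \sum_i \int[P]_t xi k i t ^+ 2 <= s.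
  have [s sP] := choice (fun i => (xi_bounded i).2).
  by exists (\sum_i s i) => k; apply: ler_sum => i _; exact: sP.
have s0 : 0 <= s.
  apply: le_trans (sP 0); apply: sumr_ge0 => i _; apply: Rintegral_ge0 => t _.
  exact: sqr_ge0.
have V_cvg : {ae P, forall t, V ^~ t @ \oo --> 0}.
  (* The drift rate comes from [G_low]. In [C1 + s], [C1] bounds the quadratic term of the drift and
     [s] the noise. *)
  apply: (@almost_supermartingale_cvg0 _ _ _ P
    (fun k => <<s \bigcup_(j in past k) F j >>) V eta (2 * (L * C2)^-1) (C1 + s)) => //.
  - by move=> k; exact: generated_measurable.
  - by move=> k; exact: (@measurableT _ (g_sigma_algebraType _)).
  - move=> k; apply: sub_sigma_algebra2; apply: bigcup_subset.
    by move=> [[l|l]|l] /= lk; exact: ltnW.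
  - move=> k B r pB; apply: adapted_setI_lt => //.
    apply: measurable_sum => i; apply: measurable_funM; first exact: measurable_cst.
    exact: measurable_funX (beta_adapted i (@subset_refl _ _)).
  - by rewrite mulr_gt0// invr_gt0 mulr_gt0.
  - by rewrite addr_ge0// ltW.
  - move=> k B pB; rewrite V_step_identity//.
    have mB : measurable B by exact: generated_measurable Fm _ _ pB.
    have subB f : rintegrable P f -> P.-integrable B (EFin \o f).
      exact: integrableS measurableT mB (@subsetT _ B).
    have iV := subB _ (V_rintegrable k).
    have up : \int[P]_(t in B) (\sum_i Gbeta k i t ^+ 2) <=
        C1 * \int[P]_(t in B) V k t.
      rewrite -(RintegralZl C1 mB iV); apply: le_Rintegral => //.
      - apply: subB; apply: rintegrable_sum => i.
        exact: (Gbeta_square_integrable k i).2.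
      - exact: subB (rintegrableZ _ (V_rintegrable k)).
    have low : (L * C2)^-1 * \int[P]_(t in B) V k t <=
        \int[P]_(t in B) (\sum_i beta k i t * Gbeta k i t).
      rewrite -(RintegralZl _ mB iV); apply: le_Rintegral => //.
      - exact: subB (rintegrableZ _ (V_rintegrable k)).
      - apply: subB; apply: rintegrable_sum => i.
        exact: square_integrableM.
    have p0 : 0 <= fine (P B) by exact: fine_ge0.
    have v0 : 0 <= \int[P]_(t in B) V k t by apply: Rintegral_ge0.
    have e2 : 0 <= eta k ^+ 2 by exact: sqr_ge0.
    have h1 := ler_wpM2l (ltW (eta0 k)) low.
    have h2 := ler_wpM2l e2 (lerD (ler_wpM2l p0 (sP k)) up).
    (* [h3] and [h4] cover the excess from using the single constant [C1 + s] in both the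
       multiplicative and the additive term. *)
    have h3 : 0 <= eta k ^+ 2 * (s * \int[P]_(t in B) V k t).
      by rewrite (mulr_ge0 e2)// (mulr_ge0 s0).
    have h4 : 0 <= eta k ^+ 2 * (C1 * fine (P B)).
      by rewrite (mulr_ge0 e2)// (mulr_ge0 (ltW C10)).
    move: h1 h2 h3 h4; lra.
apply: filterS V_cvg => t Vt; apply: cvg_col => i.
apply/cvgrPdist_lt => e e0.
(* Tolerance [e ^+ 2] for [V] gives tolerance [e] for each coordinate, whose square is at most
   [V]. *)
have /cvgrPdist_lt/(_ _ (exprn_gt0 2 e0)) := Vt; apply: filterS => k.
rewrite sub0r normrN ger0_norm// => Ve.
have : beta k i t ^+ 2 < e ^+ 2.
  apply: le_lt_trans Ve; apply: le_trans (sq_V k t).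
  by rewrite (bigD1 i)//= lerDl sumr_ge0// => j _; exact: sqr_ge0.
by rewrite -(real_normK (num_real (beta k i t))) ltr_pXn2r ?nnegrE ?(ltW e0)// distrC.
Qed.

End kaczmarz.

Theorem theorem2 (R : realType) (d : measure_display) (T : measurableType d)
  (P : probability T R) (m N : nat) (hmN : (m < N)%N)
  (A : 'M[R]_(m, N)) (hArank : \rank A = m)
  (hArows : forall i : 'I_m, eucl_norm (row i A) = 1)
  (X : T -> 'cV[R]_N) (W : T -> 'cV[R]_m) (Z : T -> 'I_m)
  (hX : random_vector X) (hW : random_vector W) (hZ : random_index Z)
  (hX2 : P.-integrable setT (fun t => (\sum_i X t i 0 ^+ 2)%:E))
  (hW2 : P.-integrable setT (fun t => (\sum_i W t i 0 ^+ 2)%:E))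
  (hW0 : forall i : 'I_m, ('E_P[(fun t => W t i 0)%R] = 0)%E)
  (lam : 'I_m -> R)
  (hlam : forall i : 'I_m, P (Z @^-1` [set i]) = (lam i)%:E /\ 0 < lam i)
  (Xs : nat -> T -> 'cV[R]_N) (Ws : nat -> T -> 'cV[R]_m)
  (Zs : nat -> T -> 'I_m)
  (hXs : forall k, random_vector (Xs k)) (hWs : forall k, random_vector (Ws k))
  (hZs : forall k, random_index (Zs k))
  (hXlaw : forall k, same_law_vec P (Xs k) X)
  (hWlaw : forall k, same_law_vec P (Ws k) W)
  (hZlaw : forall k, same_law_index P (Zs k) Z)
  (hindep : mutually_independent P
     (fun j : (nat + nat) + nat =>
        match j with
        | inl (inl k) => sigma_vec (Xs k)
        | inl (inr k) => sigma_vec (Ws k)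
        | inr k => sigma_index (Zs k)
        end))
  (eta : nat -> R) (heta_pos : forall k, 0 < eta k)
  (heta_div : series eta @ \oo --> +oo)
  (heta_sq : cvgn (series (fun k => eta k ^+ 2)))
  (x0 : 'cV[R]_N) :
  let Ys := fun k t => A *m Xs k t + Ws k t in
  let EY := \col_i fine ('E_P[(fun t => (A *m X t + W t) i 0)%R]) in
  let alpha_star := invmx (A *m A^T) *m (EY - A *m x0) in
  {ae P, forall t,
     (fun k => kaczmarz_alpha A x0 eta (fun k => Ys k t) (fun k => Zs k t) k)
       @ \oo --> alpha_star}.
Proof.
move=> Ys EY alpha_star.
exact: (kaczmarz_alpha_cvg x0 hArank hX hW hX2 hW2 hlam hXs hWs hZs hXlaw hWlaw
  hZlaw hindep heta_pos heta_div heta_sq).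
Qed.
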